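(* Let $N\ge 1$, let $\boldsymbol{\pi}=(\pi_1,\dots,\pi_N)$ be a probability vector with all $\pi_i>0$, let $\mathbf{c}$ be a random variable in $\{1,\dots,N\}$ with $P(\mathbf{c}=i)=\pi_i$, and let $\mathbf{z}\sim p_{\mathbf{z}}$ be a random noise variable independent of $\mathbf{c}$. Let $G$ be a generator, i.e. a (measurable) map $(z,c)\mapsto G(z,c)$ into the data space, and for $i=1,\dots,N$ let $p_{g_i}$ be the conditional distribution of $G(\mathbf{z},\mathbf{c})$ given $\mathbf{c}=i$. Then the mutual information between the generated sample $G(\mathbf{z},\mathbf{c})$ and the latent code $\mathbf{c}$ equals the Jensen–Shannon divergence (with weights $\boldsymbol{\pi}$) between the conditional generative distributions: $$I\big(G(\mathbf{z},\mathbf{c});\mathbf{c}\big)=\mathrm{JSD}\big(p_{g_1},\dots,p_{g_N}\big).$$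
   Context: $\mathrm{KL}(P\|Q)$ denotes the Kullback–Leibler divergence between probability distributions. The mutual information of two random variables is the KL divergence of their joint law from the product of their marginal laws. For probability distributions $P_1,\dots,P_N$ and the fixed weights $\boldsymbol{\pi}$, the Jensen–Shannon divergence is $\mathrm{JSD}(P_1,\dots,P_N)=\sum_{i=1}^N \pi_i\,\mathrm{KL}\big(P_i\,\big\|\,\sum_{j=1}^N\pi_jP_j\big)$. The (marginal) generator distribution is $p_g=\sum_{i=1}^N\pi_i p_{g_i}$. *)

(* Defs.v *)
From HB Require Import structures.
From mathcomp Require Import all_boot all_order all_algebra.
From mathcomp Require Import all_classical all_reals all_analysis.

Set Implicit Arguments.
Unset Strict Implicit.
Unset Printing Implicit Defensive.

Import Order.TTheory GRing.Theory Num.Theory.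
Import numFieldNormedType.Exports.

Local Open Scope classical_set_scope.
Local Open Scope ring_scope.
Local Open Scope charge_scope.

(* Measurable types are pointed, so a nonempty index set {1, ..., N} is encoded
   as 'I_n.+1 with N = n.+1; it carries the discrete sigma-algebra. *)
HB.instance Definition _ (n : nat) := isPointed.Build 'I_n.+1 ord0.

HB.instance Definition _ (n : nat) :=
  @isMeasurable.Build default_measure_display 'I_n.+1 discrete_measurable
    discrete_measurable0 discrete_measurableC discrete_measurableU.

Record prob_vector (R : realType) (N : nat) := ProbVector {
  weight :> 'I_N -> R ;
  weight_ge0 : forall i, 0 <= weight i ;
  weight_sum1 : \sum_(i < N) weight i = 1
}.

Section mixture.
Local Open Scope ereal_scope.
Context {d} {T : measurableType d} {R : realType} {N : nat}.
Variables (pi : prob_vector R N) (Q : 'I_N -> probability T R).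

Definition mixture (A : set T) : \bar R := \sum_(j < N) (pi j)%:E * Q j A.

Let term_ge0 j A : 0 <= (pi j)%:E * Q j A.
Proof. by rewrite mule_ge0 ?lee_fin ?weight_ge0. Qed.

Let mixture0 : mixture set0 = 0.
Proof. by rewrite /mixture big1// => j _; rewrite measure0 mule0. Qed.

Let mixture_ge0 A : 0 <= mixture A.
Proof. exact: sume_ge0. Qed.

Let mixture_sigma_additive : semi_sigma_additive mixture.
Proof.
move=> F mF tF mUF; rewrite [X in _ --> X](_ : _ =
    lim ((fun n => \sum_(0 <= i < n) mixture (F i)) @ \oo)%classic).
  by apply: is_cvg_ereal_nneg_natsum => k _; exact: mixture_ge0.
rewrite nneseries_sum//; apply: eq_bigr => /= j _.
by rewrite (@measure_semi_bigcup _ _ _ (Q j) F)// nneseriesZl.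
Qed.

HB.instance Definition _ := isMeasure.Build _ _ _ mixture
  mixture0 mixture_ge0 mixture_sigma_additive.

Let mixture_setT : mixture [set: T] = 1.
Proof.
rewrite /mixture; under eq_bigr do rewrite probability_setT mule1.
by rewrite sumEFin weight_sum1.
Qed.

HB.instance Definition _ :=
  Measure_isProbability.Build _ _ _ mixture mixture_setT.

End mixture.

(* [lne] sends 0 to -oo, but the density vanishes only on a P-null set; the
   negative part of the integrand is P-integrable, so the integral is always
   meaningful, with value in [0, +oo]. *)
Definition KL {d} {T : measurableType d} {R : realType}
    (P Q : probability T R) : \bar R :=
  if `[< P `<< Q >]
  then (\int[P]_x lne (('d (charge_of_finite_measure P) '/d Q) x))%E
  else +oo%E.

Definition JSD {d} {T : measurableType d} {R : realType} {N : nat}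
    (pi : prob_vector R N) (Q : 'I_N -> probability T R) : \bar R :=
  (\sum_(i < N) (pi i)%:E * KL (Q i) (mixture pi Q))%E.

Section random_variables.
Context {d d1 d2} {Omega : measurableType d} {T1 : measurableType d1}
  {T2 : measurableType d2} {R : realType}.
Variable P : probability Omega R.

Definition pairRV (X : {RV P >-> T1}) (Y : {RV P >-> T2}) :
    Omega -> T1 * T2 := fun w => (X w, Y w).

Lemma measurable_pairRV X Y : measurable_fun [set: Omega] (pairRV X Y).
Proof. exact: measurable_fun_pair. Qed.

HB.instance Definition _ X Y :=
  isMeasurableFun.Build _ _ _ _ (pairRV X Y) (measurable_pairRV X Y).

Definition independent_RV (X : {RV P >-> T1}) (Y : {RV P >-> T2}) : Prop :=
  forall (A : set T1) (B : set T2), measurable A -> measurable B ->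
    P (X @^-1` A `&` Y @^-1` B) = (P (X @^-1` A) * P (Y @^-1` B))%E.

Definition mutual_information (X : {RV P >-> T1}) (Y : {RV P >-> T2}) :
    \bar R :=
  KL (distribution P (pairRV X Y)) (distribution P X \x distribution P Y)%E.

End random_variables.

Section conditioning.
Context {d d'} {Omega : measurableType d} {T : measurableType d'}
  {R : realType}.

(* U |-> P (U `&` E) / P E; when P E = 0 it is P by convention. *)
Definition cond_prob (P : probability Omega R) (E : set Omega)
    (mE : measurable E) : probability Omega R :=
  mnormalize (mrestr P mE) P.

Lemma measurable_fiber (n : nat) (P : probability Omega R)
  (c : {RV P >-> 'I_n.+1}) (i : 'I_n.+1) : measurable (c @^-1` [set i]).
Proof. exact: measurable_funPTI. Qed.

Definition cond_distribution (n : nat) (P : probability Omega R)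
    (X : {RV P >-> T}) (c : {RV P >-> 'I_n.+1}) (i : 'I_n.+1) :
    probability T R :=
  distribution (cond_prob P (measurable_fiber c i)) X.

End conditioning.

Section generated_sample.
Context {d dz dx} {Omega : measurableType d} {Z : measurableType dz}
  {X : measurableType dx} {R : realType} {P : probability Omega R} {n : nat}.

Definition generated (G : {mfun (Z * 'I_n.+1)%type >-> X}) (z : {RV P >-> Z})
  (c : {RV P >-> 'I_n.+1}) : {RV P >-> X} := G \o pairRV z c.

End generated_sample.

(* Main.v *)
(* Write M for the mixture of the p_{g_i}, i.e. the law of the generated
   sample.  Both the joint law and the product of the marginals are sums over i
   of pi_i times a measure carried by the slice X * {i}: p_{g_i} for the former,
   M for the latter.  Since p_{g_i} << M, the function (x, i) |-> dp_{g_i}/dM x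
   is a density of the joint law with respect to the product, and integrating
   its logarithm slice by slice gives the Jensen-Shannon divergence.  The
   integral may be distributed over the slices because the negative parts of
   the log-densities are integrable. *)
Require Import Defs.
From HB Require Import structures.
From mathcomp Require Import all_boot all_order all_algebra.
From mathcomp Require Import all_classical all_reals all_analysis.
From mathcomp Require Import measurable_realfun.

Set Implicit Arguments.
Unset Strict Implicit.
Unset Printing Implicit Defensive.

Import Order.TTheory GRing.Theory Num.Theory.
Import numFieldNormedType.Exports.

Local Open Scope classical_set_scope.
Local Open Scope ring_scope.

(** * The extended logarithm *)

Section lne.
Context {R : realType}.
Local Open Scope ereal_scope.

Lemma measurable_lne : measurable_fun setT (@lne R).
Proof.
rewrite (_ : @lne R = fun x => if x <= 0 then -oo
    else if x == +oo then +oo else (ln (fine x))%:E); last first.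
  by apply/funext => -[r| |]//=; rewrite ?lee_fin ?leNye.
apply: measurable_fun_ifT => //.
  by apply: measurable_fun_lee => //; exact: measurable_cst.
apply: measurable_fun_ifT => //.
  by apply: measurable_fun_eqe => //; exact: measurable_cst.
apply/measurable_EFinP; apply: measurableT_comp; first exact: measurable_ln.
exact: fine_measurable.
Qed.

(* At [x = 0] the product is [+oo * 0 = 0]. *)
Lemma lne_funeneg_mul_le1 (x : \bar R) : 0 <= x -> x \is a fin_num ->
  maxe (- lne x) 0 * x <= 1.
Proof.
case: x => [r| |] // r0 _.
have [->|r_neq0] := eqVneq r 0%R; first by rewrite mule0.
have {r_neq0}r_gt0 : (0 < r)%R by rewrite lt_neqAle eq_sym r_neq0 -lee_fin.
rewrite lne_EFin// maxe_pMl ?lee_fin ?(ltW r_gt0)//.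
(* What remains is [ln r^-1 * r <= 1], i.e. [ln y <= y] at [y = r^-1]. *)
rewrite mul0e ge_max lee01 andbT -EFinN -EFinM lee_fin -lnV ?posrE//.
by rewrite -ler_pdivlMr// div1r ltW// ln_sublinear// invr_gt0//.
Qed.

End lne.

(** * Divergences through densities, and domination by a mixture *)

Section KL_density.
Context {d} {T : measurableType d} {R : realType}.
Variables P Q : probability T R.
Local Open Scope ereal_scope.
Local Open Scope charge_scope.
Local Notation density := (Radon_Nikodym_SigmaFinite.f P Q).

(** Densities are unique [Q]-a.e., and [P << Q] turns this into equality [P]-a.e., so a divergence
    may be computed with any explicit density. *)
Lemma KL_density (g : T -> \bar R) : P `<< Q -> measurable_fun setT g ->
  (forall A, measurable A -> P A = \int[Q]_(x in A) g x) ->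
  KL P Q = \int[P]_x lne (g x).
Proof.
move=> PQ mg Pg; rewrite /KL; case: asboolP => // _.
apply: ae_eq_integral => //.
- by apply: measurableT_comp; [exact: measurable_lne|].
- by apply: measurableT_comp; [exact: measurable_lne|].
have ae_g : ae_eq Q setT ('d (charge_of_finite_measure P) '/d Q) g.
  apply: integral_ae_eq => //; first exact: Radon_Nikodym_integrable.
  by move=> E _ mE; rewrite -Radon_Nikodym_integral//= Pg.
have := null_dominates_ae_eq measurableT PQ ae_g.
by apply: filterS => x /[swap] _ /(_ I) ->.
Qed.

(* Changing variables, the integral is that of [g (ln g)^- <= 1] against [Q],
   where [g] is the density. *)
Lemma lne_density_funeneg_lty : P `<< Q ->
  \int[P]_x (@lne R \o density)^\- x < +oo.
Proof.
move=> PQ.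
have mf : measurable_fun setT density.
  by apply: measurable_int; exact: Radon_Nikodym_SigmaFinite.f_integrable.
have mlf : measurable_fun setT (@lne R \o density)^\-.
  apply: measurable_funeneg; apply: measurableT_comp => //.
  exact: measurable_lne.
rewrite -(Radon_Nikodym_SigmaFinite.change_of_variables PQ)//.
apply: (@le_lt_trans _ _ (\int[Q]_x (cst 1 x))); last first.
  by rewrite integral_cst// mul1e [ltLHS](probability_setT Q) ltry.
apply: ge0_le_integral => //.
- move=> x _; apply: mule_ge0; first exact: funeneg_ge0.
  exact: Radon_Nikodym_SigmaFinite.f_ge0.
- exact: emeasurable_funM.
- move=> x _; rewrite funenegE; apply: lne_funeneg_mul_le1.
    exact: Radon_Nikodym_SigmaFinite.f_ge0.
  exact: Radon_Nikodym_SigmaFinite.f_fin_num.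
Qed.

End KL_density.

(** A vanishing sum of nonnegative terms has only zero terms, and the positive weight can be
    cancelled. *)
Lemma mixture_dominates {d} {T : measurableType d} {R : realType} {N : nat}
    (pi : prob_vector R N) (Q : 'I_N -> probability T R) (i : 'I_N) :
  0 < pi i -> Q i `<< mixture pi Q.
Proof.
move=> pi0; apply/null_content_dominatesP => A mA /eqP.
rewrite /= /mixture seq_psume_eq0; last first.
  by move=> j _; rewrite mule_ge0 ?lee_fin ?weight_ge0.
move=> /allP/(_ i); rewrite mem_index_enum => /(_ isT)/=.
by rewrite mule_eq0 eqe gt_eqF//= => /eqP.
Qed.

(** * Slicing measures and integrals along a finite index *)

Section finite_partition.
Context {d} {T : measurableType d} {R : realType} {n : nat}.
Local Open Scope ereal_scope.

(** A preimage is a finite union of rectangles, one per index. *)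
Lemma measurable_fun_prod_ord {d'} {T' : measurableType d'}
    (f : 'I_n.+1 -> T -> T') : (forall i, measurable_fun setT (f i)) ->
  measurable_fun setT (fun p : T * 'I_n.+1 => f p.2 p.1).
Proof.
move=> mf _ B mB; rewrite setTI.
rewrite (_ : _ @^-1` _ =
    \big[setU/set0]_(i < n.+1) ((f i @^-1` B) `*` [set i])); last first.
  rewrite -bigcup_mkord_ord; apply/seteqP; split => [[x i] /= Bfix|[x i]].
    by exists i => //=; rewrite inord_val.
  by move=> [k _ [/= + ->]].
apply: bigsetU_measurable => i _; apply: measurableX => //.
by rewrite -[X in measurable X]setTI; exact: mf.
Qed.

Lemma measure_fiber_sum (P : {measure set T -> \bar R})
    (c : T -> 'I_n.+1) (mc : measurable_fun setT c) (A : set T) :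
  measurable A -> P A = \sum_(i < n.+1) P (A `&` c @^-1` [set i]).
Proof.
move=> mA; rewrite -measure_bigsetU_ord.
- rewrite -bigcup_mkord_ord -setI_bigcupr.
  rewrite (_ : \bigcup_(i in _) _ = setT) ?setIT//.
  by apply/seteqP; split => // x _; exists (c x) => //=; rewrite inord_val.
- move=> i; apply: measurableI => //.
  by rewrite -[X in measurable X]setTI; exact: mc.
- apply/trivIsetP => i j _ _ /eqP ij; apply/seteqP; split => // x.
  by move=> [[_ /= ci] [_ /= cj]]; apply: ij; rewrite -ci -cj.
Qed.

(** [J] is the finite sum of the images of [Q i] under [x |-> (x, i)], scaled by [pi i], and
    integration is additive in the measure. It serves both the joint law and, with a constant family
    [Q], the product of the marginals. *)
Lemma integral_slices (pi : prob_vector R n.+1)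
    (Q : 'I_n.+1 -> probability T R)
    (J : {measure set (T * 'I_n.+1) -> \bar R}) :
  (forall B, measurable B ->
    J B = \sum_(i < n.+1) (pi i)%:E * Q i (ysection B i)) ->
  forall f : T * 'I_n.+1 -> \bar R, (forall p, 0 <= f p) ->
  measurable_fun setT f ->
  \int[J]_p f p = \sum_(i < n.+1) (pi i)%:E * \int[Q i]_x f (x, i).
Proof.
move=> JE f f0 mf.
have mpair (i : 'I_n.+1) : measurable_fun setT (fun x : T => (x, i)).
  exact: pair2_measurable.
pose m i : {measure set (T * 'I_n.+1) -> \bar R} :=
  mscale (NngNum (weight_ge0 pi i)) (pushforward (Q i) (fun x => (x, i))).
rewrite (eq_measure_integral (msum (fun k => m mpair (inord k)) n.+1)).
  rewrite ge0_integral_measure_sum//; apply: eq_bigr => i _.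
  by rewrite inord_val /m ge0_integral_mscale//= ge0_integral_pushforward//=.
move=> B mB _; rewrite JE//= /msum; apply: eq_bigr => i _.
by rewrite inord_val /m/= /mscale/= /pushforward ysectionE.
Qed.

End finite_partition.

Lemma KL_mixture_JSD {d} {T : measurableType d} {R : realType} {n : nat}
    (pi : prob_vector R n.+1) (Q : 'I_n.+1 -> probability T R)
    (J M : probability (T * 'I_n.+1)%type R) :
  (forall i, 0 < pi i) ->
  (forall B, measurable B ->
    J B = (\sum_(i < n.+1) (pi i)%:E * Q i (ysection B i))%E) ->
  (forall B, measurable B ->
    M B = (\sum_(i < n.+1) (pi i)%:E * mixture pi Q (ysection B i))%E) ->
  KL J M = JSD pi Q.
Proof.
move=> pi_gt0 JE ME.
have QM i := mixture_dominates (Q := Q) (pi_gt0 i).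
pose g i := Radon_Nikodym_SigmaFinite.f (Q i) (mixture pi Q).
have g_ge0 i x : (0 <= g i x)%E
  by exact: Radon_Nikodym_SigmaFinite.f_ge0 (QM i) x.
have mg i : measurable_fun setT (g i).
  apply: measurable_int.
  exact: Radon_Nikodym_SigmaFinite.f_integrable (QM i).
have mlg i : measurable_fun setT (fun x => lne (g i x)).
  by apply: measurableT_comp => //; exact: measurable_lne.
(* Since the weights are positive, every slice of an [M]-null set is null for the mixture, hence for
   [Q i]. *)
have JM : J `<< M.
  apply/null_content_dominatesP => B mB MB0.
  have /eqP := etrans (esym (ME B mB)) MB0.
  rewrite seq_psume_eq0; last first.
    by move=> i _; rewrite mule_ge0 ?lee_fin ?weight_ge0.
  move=> /allP MBi0; rewrite JE//; apply: big1 => i _.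
  have := MBi0 i; rewrite mem_index_enum => /(_ isT)/=.
  rewrite mule_eq0 eqe gt_eqF//= => /eqP {}MBi0.
  have /null_content_dominatesP/(_ _ (measurable_ysection i mB)) := QM i.
  by move=> ->//; rewrite mule0.
rewrite (KL_density JM (g := fun p => g p.2 p.1)); last 2 first.
- exact: measurable_fun_prod_ord.
- move=> B mB; rewrite JE// integral_mkcond.
  rewrite (integral_slices (pi := pi) (Q := fun=> mixture pi Q))//.
  + apply: eq_bigr => i _; congr (_ * _)%E.
    rewrite [LHS](Radon_Nikodym_SigmaFinite.f_integral (QM i)); last first.
      exact: measurable_ysection.
    rewrite integral_mkcond; apply: eq_integral => x _.
    by rewrite !patchE mem_ysection.
  + by move=> p; apply: erestrict_ge0 => q _.
  + apply/(measurable_restrictT _ mB); apply: measurable_funTS.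
    exact: measurable_fun_prod_ord.
(* Slicing applies to nonnegative functions only, so the two parts of the log-density are sliced
   separately. *)
rewrite integralE !(integral_slices JE)//; first last.
- by apply: measurable_funepos; exact: (measurable_fun_prod_ord mlg).
- by apply: measurable_funeneg; exact: (measurable_fun_prod_ord mlg).
rewrite /JSD.
(* Finiteness rules out [+oo - +oo] when the two sums are recombined term by term. *)
have neg_fin i : (\int[Q i]_x (fun x => lne (g i x))^\- x)%E \is a fin_num.
  rewrite ge0_fin_numE; first exact: lne_density_funeneg_lty (QM i).
  by apply: integral_ge0 => x _; exact: funeneg_ge0.
have posE i : (\int[Q i]_x (fun p => lne (g p.2 p.1))^\+ (x, i) =
    \int[Q i]_x (fun x => lne (g i x))^\+ x)%E.
  by apply: eq_integral => x _; rewrite !funeposE.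
have negE i : (\int[Q i]_x (fun p => lne (g p.2 p.1))^\- (x, i) =
    \int[Q i]_x (fun x => lne (g i x))^\- x)%E.
  by apply: eq_integral => x _; rewrite !funenegE.
under eq_bigr do rewrite posE.
under [X in (_ - X)%E]eq_bigr do rewrite negE.
rewrite -fin_num_sumeN; last first.
  by move=> i _; apply: fin_numM => //; exact: neg_fin.
rewrite -big_split/=; apply: eq_bigr => i _.
rewrite (KL_density (QM i) (mg i)); last first.
  exact: Radon_Nikodym_SigmaFinite.f_integral (QM i).
rewrite (integralE _ _ (fun x => lne (g i x))) [RHS]muleBr//.
by rewrite fin_num_adde_defl// fin_numN neg_fin.
Qed.

(** * From conditional laws to mutual information *)

Lemma cond_distributionE {d d'} {Omega : measurableType d}
    {T : measurableType d'} {R : realType} {n : nat} (P : probability Omega R)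
    (X : {RV P >-> T}) (c : {RV P >-> 'I_n.+1}) (i : 'I_n.+1) (A : set T) :
  (P (c @^-1` [set i]) != 0)%E ->
  (P (c @^-1` [set i]) * cond_distribution X c i A =
    P (X @^-1` A `&` c @^-1` [set i]))%E.
Proof.
set E := c @^-1` [set i]; move=> PE0.
have Pfin : P E \is a fin_num.
  by apply: fin_num_measure; exact: measurable_fiber.
have -> : cond_distribution X c i A =
    ((if (P (setT `&` E) == 0) || (P (setT `&` E) == +oo) then [eta P]
      else fun U => P (U `&` E) * (fine (P (setT `&` E)))^-1%:E)
    (X @^-1` A))%E by [].
(* The default branch of [mnormalize] is excluded: the conditioning event has nonzero finite
   mass. *)
rewrite setTI (negbTE PE0)/=.
rewrite (_ : (_ == +oo)%E = false) ?orbF//; last by case: (P _) Pfin.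
rewrite muleCA -[X in (X * _%:E)%E]fineK// -EFinM mulfV ?mule1//.
by rewrite fine_eq0.
Qed.

Lemma mutual_information_JSD {d d'} {Omega : measurableType d}
    {T : measurableType d'} {R : realType} {n : nat} (P : probability Omega R)
    (pi : prob_vector R n.+1) (X : {RV P >-> T}) (c : {RV P >-> 'I_n.+1}) :
  (forall i, 0 < pi i) -> (forall i, P (c @^-1` [set i]) = (pi i)%:E) ->
  mutual_information X c = JSD pi (cond_distribution X c).
Proof.
move=> pi_gt0 c_law.
have slice i A : ((pi i)%:E * cond_distribution X c i A =
    P (X @^-1` A `&` c @^-1` [set i]))%E.
  by rewrite -c_law cond_distributionE// c_law eqe gt_eqF.
(* The law of [c] as a sum of point masses, used below to measure the x-sections in the product
   measure. *)
have c_set S : P (c @^-1` S) = (\sum_(i < n.+1) (pi i)%:E * (\1_S i)%:E)%E.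
  rewrite (measure_fiber_sum P (c := c))//; last exact: measurable_funPTI.
  apply: eq_bigr => i _; rewrite -c_law indicE; case: (boolP (i \in S)) => iS.
    rewrite mule1; congr (P _); apply/seteqP; split => x /=; first by case.
    by move=> ci; split => //; rewrite ci; exact: set_mem.
  rewrite mule0 (_ : _ `&` _ = set0) ?measure0//.
  apply/seteqP; split => x //= [Scx ci]; move/negP: iS; apply.
  by apply/mem_set; rewrite -ci.
have X_set A : measurable A ->
    P (X @^-1` A) = mixture pi (cond_distribution X c) A.
  move=> mA.
  rewrite (measure_fiber_sum P (c := c))//; last exact: measurable_funPTI.
  by apply: eq_bigr => i _; rewrite slice.
apply: KL_mixture_JSD => // B mB.
- rewrite [LHS]/= /distribution /pushforward.
  rewrite (measure_fiber_sum P (c := c))//; last exact: measurable_funPTI.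
  (* On the event [c = i], the pair lies in [B] exactly when [X] lies in the section of [B] at
     [i]. *)
  apply: eq_bigr => i _; rewrite slice; congr (P _).
  apply/seteqP; split => w /= [Bw cw]; split => //; move: Bw;
    by rewrite /pairRV /ysection/= inE cw.
- have indicE x i : \1_(xsection B x) i = \1_(ysection B i) x :> R.
    by rewrite !indicE mem_xsection mem_ysection.
  rewrite [LHS]/= /product_measure1/=.
  (* Expanding the measure of each x-section into point masses and exchanging sum and integral
     leaves the law of [X] on the y-sections. *)
  under eq_integral do rewrite /distribution /pushforward c_set.
  have mind i : measurable_fun setT
      (fun x => (\1_(xsection B x) i)%:E : \bar R).
    under eq_fun do rewrite indicE.
    apply/measurable_EFinP; apply: measurable_indic.
    exact: measurable_ysection.
  rewrite ge0_integral_sum//.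
  + apply: eq_bigr => i _.
    rewrite ge0_integralZl_EFin ?weight_ge0//; congr (_ * _)%E.
    under eq_integral do rewrite indicE.
    rewrite integral_indic ?setIT//; last exact: measurable_ysection.
    by rewrite -X_set//; exact: measurable_ysection.
  + by move=> i; apply: emeasurable_funM => //; exact: measurable_cst.
  + by move=> i x _; rewrite mule_ge0 ?lee_fin ?weight_ge0.
Qed.

Theorem theorem3p1 (R : realType) (n : nat)
  (pi : prob_vector R n.+1) (pi_gt0 : forall i : 'I_n.+1, 0 < pi i)
  (d : measure_display) (Omega : measurableType d) (P : probability Omega R)
  (c : {RV P >-> 'I_n.+1}) (c_law : forall i : 'I_n.+1, P (c @^-1` [set i]) = (pi i)%:E)
  (dz : measure_display) (Z : measurableType dz) (pz : probability Z R)
  (z : {RV P >-> Z})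
  (z_law : forall A : set Z, measurable A -> distribution P z A = pz A)
  (zc_indep : independent_RV z c)
  (dx : measure_display) (X : measurableType dx)
  (G : {mfun (Z * 'I_n.+1)%type >-> X}) :
  mutual_information (generated G z c) c
  = JSD pi (cond_distribution (generated G z c) c).
Proof. exact: mutual_information_JSD. Qed.
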